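(* Let $\phi_{out}\le a\,\phi_{in}^2/k^2$ for a sufficiently small absolute constant $a>0$. Let $G$ be a weighted $d$-regular $n$-vertex graph that is $(k,\phi_{in},\phi_{out})$-clusterable with underlying $(\phi_{in},\phi_{out})$-clusters $C_1,\dots,C_h$, $h\le k$. Let $\mathbf r_i=\frac{1}{\sqrt{|C_i|}}\mathbf 1_{C_i}$. Then there exist $h$ orthonormal vectors $\tilde{\mathbf r}_1,\dots,\tilde{\mathbf r}_h\in\mathrm{Span}(\mathbf r_1,\dots,\mathbf r_h)$ and an absolute constant $c>0$ such that for each $i\le h$, $$\|\mathbf v_i-\tilde{\mathbf r}_i\|_2^2\le c\cdot\frac{h\phi_{out}}{\phi_{in}^2}.$$
   Context: A weighted $d$-regular graph has a symmetric nonnegative adjacency matrix $A$ (self-loops allowed) with all row sums equal to $d$. For $S\subseteq V$, $\phi_G(S)=\frac{w(S,V\setminus S)}{d|S|}$ with $w(S,T)=\sum_{u\in S,v\in T}A(u,v)$; the inner conductance of $S$ is $\min_{T\subseteq S,|T|\le|S|/2}\frac{w(T,S\setminus T)}{d|T|}$ (equal to $1$ if $|S|=1$). A $(\phi_{in},\phi_{out})$-cluster has inner conductance $\ge\phi_{in}$ and $\phi_G\le\phi_{out}$; $(k,\phi_{in},\phi_{out})$-clusterable means $V$ is partitioned into $h\le k$ such clusters. $L=I-\frac1dA$ is the normalized Laplacian with eigenvalues $0=\lambda_1\le\dots\le\lambda_n\le2$ and corresponding orthonormal eigenvectors $\mathbf v_1,\dots,\mathbf v_n$. $\mathbf 1_C$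 is the indicator vector of $C$. *)

(* Defs.v *)
From HB Require Import structures.
From mathcomp Require Import all_boot all_order all_algebra.
From mathcomp Require Import reals.

Set Implicit Arguments.
Unset Strict Implicit.
Unset Printing Implicit Defensive.

Import Order.TTheory GRing.Theory Num.Theory.
Local Open Scope ring_scope.

Section EuclideanSpace.
Variables (R : realType) (n : nat).
Implicit Types u v : 'cV[R]_n.

Definition dotp u v : R := \sum_i u i 0 * v i 0.

(* The norm on matrices provided by MathComp-Analysis is the sup norm. *)
Definition norm2 u : R := Num.sqrt (dotp u u).

Definition orthonormal_family m (u : 'I_m -> 'cV[R]_n) : Prop :=
  forall i j, dotp (u i) (u j) = (i == j)%:R.

(* Since [v] has [n] orthonormal members, [lam] lists all the eigenvalues
   of [M], repeated according to multiplicity. *)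
Definition ordered_eigenbasis (M : 'M[R]_n)
    (lam : 'I_n -> R) (v : 'I_n -> 'cV[R]_n) : Prop :=
  [/\ forall i j : 'I_n, (i <= j)%N -> lam i <= lam j,
      orthonormal_family v
    & forall i, M *m v i = lam i *: v i].

End EuclideanSpace.

Section WeightedGraph.
Variables (R : realType) (n : nat) (d : R) (A : 'M[R]_n).
Implicit Types S T : {set 'I_n}.

Definition weighted_regular : Prop :=
  [/\ 0 < d, A^T = A, forall u v, 0 <= A u v & forall u, \sum_v A u v = d].

Definition cut_weight S T : R := \sum_(u in S) \sum_(v in T) A u v.

Definition conductance S : R := cut_weight S (~: S) / (d * #|S|%:R).

(* The values whose minimum is the inner conductance: [T] ranges over the
   nonempty subsets of [S] with at most half its elements. *)
Definition inner_ratios S : seq R :=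
  [seq cut_weight T (S :\: T) / (d * #|T|%:R)
     | T <- enum [set T : {set 'I_n} |
                   [&& T != set0, T \subset S & (2 * #|T| <= #|S|)%N]]].

(* [inner_ratios S] is empty exactly when [S] has at most one element. *)
Definition inner_conductance S : R :=
  if inner_ratios S is x :: s then \big[Num.min/x]_(y <- s) y else 1.

Definition cluster (phi_in phi_out : R) S : Prop :=
  phi_in <= inner_conductance S /\ conductance S <= phi_out.

(* Injectivity of [C] makes the [h] clusters distinct; [partition] makes them
   nonempty, disjoint and covering. *)
Definition clustering (k : nat) (phi_in phi_out : R)
    (h : nat) (C : 'I_h -> {set 'I_n}) : Prop :=
  [/\ (h <= k)%N,
      injective C,
      partition [set C i | i : 'I_h] [set: 'I_n]
    & forall i, cluster phi_in phi_out (C i)].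

Definition laplacian : 'M[R]_n := 1%:M - d^-1 *: A.

End WeightedGraph.

Definition indicator (R : realType) n (S : {set 'I_n}) : 'cV[R]_n :=
  \col_u (u \in S)%:R.

Definition normalized_indicator (R : realType) n (S : {set 'I_n}) : 'cV[R]_n :=
  (Num.sqrt #|S|%:R)^-1 *: indicator R S.

(* Main.v *)
Require Import Defs.
From HB Require Import structures.
From mathcomp Require Import all_boot all_order all_algebra.
From mathcomp Require Import reals.
From mathcomp Require Import ring lra.

Set Implicit Arguments.
Unset Strict Implicit.
Unset Printing Implicit Defensive.

Import Order.TTheory GRing.Theory Num.Theory.
Local Open Scope ring_scope.

(** Let [P] be the orthogonal projection onto the span of the normalized cluster
    indicators. Testing the Laplacian on that span gives [lam j <= 2 phi_out]
    for the first [h] eigenvalues (Courant-Fischer), while Cheeger's inequality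
    inside each cluster bounds [phi_in^2 |v - P v|^2] by twice the Rayleigh
    quotient of [v]. Hence the first [h] eigenvectors satisfy
    [|v_i - P v_i|^2 <= e] with [e = 4 phi_out / phi_in^2], so the Gram matrix
    of the [P v_i] is entrywise within [e] of the identity. Since [h e] is
    small, Gram-Schmidt moves each [P v_i] by at most [2 e] in squared norm:
    the coefficients of its projection onto the previous vectors solve a
    diagonally dominant system, so they are at most [2 e] in absolute value. *)

(** * Bilinearity and elementary inequalities for the dot product *)

Section DotProduct.
Variables (R : realType) (n : nat).
Implicit Types u v w : 'cV[R]_n.

Lemma dotpC u v : dotp u v = dotp v u.
Proof. by apply: eq_bigr => i _; rewrite mulrC. Qed.

Lemma dotpDl u v w : dotp (u + v) w = dotp u w + dotp v w.
Proof. by rewrite -big_split; apply: eq_bigr => i _; rewrite mxE mulrDl. Qed.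

Lemma dotpZl a u v : dotp (a *: u) v = a * dotp u v.
Proof. by rewrite mulr_sumr; apply: eq_bigr => i _; rewrite mxE mulrA. Qed.

Lemma dotpDr u v w : dotp u (v + w) = dotp u v + dotp u w.
Proof. by rewrite dotpC dotpDl !(dotpC u). Qed.

Lemma dotpZr a u v : dotp u (a *: v) = a * dotp u v.
Proof. by rewrite dotpC dotpZl dotpC. Qed.

Lemma dotpNl u v : dotp (- u) v = - dotp u v.
Proof. by rewrite -scaleN1r dotpZl mulN1r. Qed.

Lemma dotpNr u v : dotp u (- v) = - dotp u v.
Proof. by rewrite dotpC dotpNl dotpC. Qed.

Lemma dotp_suml (I : finType) (F : I -> 'cV[R]_n) v :
  dotp (\sum_i F i) v = \sum_i dotp (F i) v.
Proof.
rewrite exchange_big; apply: eq_bigr => i _.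
by rewrite summxE mulr_suml.
Qed.

Lemma dotp_sumr (I : finType) (F : I -> 'cV[R]_n) v :
  dotp v (\sum_i F i) = \sum_i dotp v (F i).
Proof. by rewrite dotpC dotp_suml; apply: eq_bigr => i _; rewrite dotpC. Qed.

Definition dotpE := (dotpDl, dotpDr, dotpNl, dotpNr, dotpZl, dotpZr).

Lemma dotp_ge0 u : 0 <= dotp u u.
Proof. by apply: sumr_ge0 => i _; rewrite -expr2 sqr_ge0. Qed.

Lemma norm2_sqr u : norm2 u ^+ 2 = dotp u u.
Proof. by rewrite sqr_sqrtr ?dotp_ge0. Qed.

Lemma dotp_sqrD_le u v :
  dotp (u + v) (u + v) <= 2 * (dotp u u + dotp v v).
Proof.
by have := dotp_ge0 (u - v); rewrite !dotpE (dotpC v u); lra.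
Qed.

(** Expand the nonnegative squared norms of [u + v] and [u - v]. *)
Lemma normr_dotp_le u v e :
  dotp u u <= e -> dotp v v <= e -> `|dotp u v| <= e.
Proof.
move=> hu hv; have := dotp_ge0 (u - v); have := dotp_ge0 (u + v).
rewrite !dotpE (dotpC v u) ler_norml => h1 h2.
by apply/andP; split; lra.
Qed.

Lemma dotp_orthonormal_sum h (r : 'I_h -> 'cV[R]_n) (a b : 'I_h -> R) :
  orthonormal_family r ->
  dotp (\sum_i a i *: r i) (\sum_i b i *: r i) = \sum_i a i * b i.
Proof.
move=> rP; rewrite dotp_suml; apply: eq_bigr => i _.
rewrite dotp_sumr (bigD1 i) //= big1 => [|j /negPf jNi].
  by rewrite addr0 !dotpE rP eqxx mulr1.
by rewrite !dotpE rP eq_sym jNi !mulr0.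
Qed.

End DotProduct.

(** * Gram-Schmidt for nearly orthonormal vectors *)

Section PerturbedGramSchmidt.
Variables (R : realType).

(** Summing the hypothesis over [i] bounds the sum [s] of the [|x i|] by [h b + h e s], hence by
    [2 h b]; feeding this back into the hypothesis gives [b + 2 h e b <= 2 b]. *)
Lemma norm_le_of_contraction h (e b : R) (x : 'I_h -> R) :
    0 <= e -> 0 <= b -> h%:R * e <= 1 / 2 ->
    (forall i, `|x i| <= b + \sum_j `|x j| * e) ->
  forall i, `|x i| <= 2 * b.
Proof.
move=> e0 b0 he xP i; rewrite -mulr_suml in xP.
set s := \sum_j `|x j|; have s0 : 0 <= s by apply: sumr_ge0.
have sP : s <= h%:R * (b + s * e).
  rewrite -[h in h%:R](card_ord h) mulr_natl -sumr_const.
  by apply: ler_sum => j _; apply: xP.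
have : s <= 2 * (h%:R * b) by nra.
have := xP i; rewrite -/s => h1 h2.
have : s * e <= 2 * (h%:R * b) * e by apply: ler_wpM2r.
have : (h%:R * e) * b <= 1 / 2 * b by apply: ler_wpM2r.
by lra.
Qed.

(** The contraction bound serves twice: with right-hand side 0 it shows that [1 - E] has trivial
    kernel, hence is invertible, and with [b] it bounds the solution. *)
Lemma solve_near_identity h (e : R) (E : 'M[R]_h) (b : 'rV[R]_h) :
    0 <= e -> h%:R * e <= 1 / 2 ->
    (forall i j, `|E i j| <= e) -> (forall j, `|b 0 j| <= e) ->
  exists2 c : 'rV[R]_h, c = b + c *m E & forall j, `|c 0 j| <= 2 * e.
Proof.
move=> e0 he EP bP.
have bound (x y : 'rV[R]_h) g : 0 <= g -> x = y + x *m E ->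
    (forall j, `|y 0 j| <= g) -> forall j, `|x 0 j| <= 2 * g.
  move=> g0 xE yP; apply: (norm_le_of_contraction e0) => // j.
  rewrite {1}xE mxE (le_trans (ler_normD _ _)) // lerD // mxE.
  rewrite (le_trans (ler_norm_sum _ _ _)) //; apply: ler_sum => i _.
  by rewrite normrM ler_wpM2l.
have U : (1%:M - E) \in unitmx.
  rewrite unitmxE unitfE; apply/negP => /det0P [x /eqP x0].
  rewrite mulmxBr mulmx1 => /eqP; rewrite subr_eq0 => /eqP xE.
  apply: x0; apply/rowP => j; rewrite [RHS]mxE; apply/eqP.
  rewrite -normr_le0 -(mulr0 2); apply: (bound x 0) => //.
    by rewrite add0r.
  by move=> k; rewrite mxE normr0.
exists (b *m invmx (1%:M - E)).
  by apply/eqP; rewrite -subr_eq -{1}[b *m invmx _]mulmx1 -mulmxBr mulmxKV.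
apply: (bound _ b) => //.
by apply/eqP; rewrite -subr_eq -{1}[b *m invmx _]mulmx1 -mulmxBr mulmxKV.
Qed.

Variables (n h : nat) (w : 'I_h -> 'cV[R]_n) (e : R).
Hypothesis e_small : h%:R * e <= 1 / 8.
Hypothesis w_near_orthonormal :
  forall i j, `|dotp (w i) (w j) - (i == j)%:R| <= e.

Lemma near_orthonormal_err_ge0 (i : 'I_h) : 0 <= e.
Proof. exact: le_trans (w_near_orthonormal i i). Qed.

Lemma near_orthonormal_err_le (i : 'I_h) : e <= 1 / 8.
Proof.
apply: le_trans e_small; rewrite ler_peMl ?(near_orthonormal_err_ge0 i) //.
by rewrite ler1n; case: h i => // -[].
Qed.

(** The [c l] are the coefficients of the projection [p] of [w i] onto the span of the earlier
    vectors, found by solving the normal equations. *)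
Lemma near_orthonormal_residual (i : 'I_h) :
  exists c : 'I_h -> R,
    [/\ forall l : 'I_h, (i <= l)%N -> c l = 0,
        forall j : 'I_h, (j < i)%N -> dotp (w j) (w i - \sum_l c l *: w l) = 0
      & let p := \sum_l c l *: w l in
        dotp p (w i - p) = 0 /\ dotp p p <= e].
Proof.
have e0 := near_orthonormal_err_ge0 i.
(* The system on indices below [i] is padded with zeros to size [h], so that its solution
   automatically vanishes from index [i] on. *)
pose E := \matrix_(l, j) (if (l < i)%N && (j < i)%N
                          then (l == j)%:R - dotp (w l) (w j) else 0).
pose b := \row_j (if (j < i)%N then dotp (w j) (w i) else 0).
have EP l j : `|E l j| <= e.
  by rewrite mxE; case: ifP => _; rewrite ?normr0 // distrC.
have bP j : `|b 0 j| <= e.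
  rewrite mxE; case: ifP => ji; rewrite ?normr0 //.
  have := w_near_orthonormal j i; suff -> : (j == i) = false by rewrite subr0.
  by apply/eqP => ij; rewrite ij ltnn in ji.
have [|c cE cP] := solve_near_identity e0 _ EP bP.
  by apply: le_trans e_small _; lra.
have c0 (l : 'I_h) : (i <= l)%N -> c 0 l = 0.
  move=> il; rewrite cE mxE [b _ _]mxE ltnNge il /= mxE big1 ?addr0 // => j _.
  by rewrite mxE (ltnNge l) il /= andbF mulr0.
have orth (j : 'I_h) : (j < i)%N -> dotp (w j) (w i - \sum_l c 0 l *: w l) = 0.
  move=> ji; rewrite dotpDr dotpNr dotp_sumr.
  (* Coordinate [j] of [c = b + c E] is the normal equation for [w j]. *)
  have := congr1 (fun m : 'rV[R]_h => m 0 j) cE.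
  rewrite mxE [b _ _]mxE ji mxE.
  have -> : \sum_l c 0 l * E l j =
            c 0 j - \sum_l dotp (w j) (c 0 l *: w l).
    have -> : c 0 j = \sum_l c 0 l * (l == j)%:R.
      rewrite (bigD1 j) //= eqxx mulr1 big1 ?addr0 // => l /negPf ->.
      by rewrite mulr0.
    rewrite -sumrB; apply: eq_bigr => l _; rewrite mxE ji andbT dotpZr.
    rewrite dotpC; case: ltnP => [_|/c0 ->]; last by rewrite !mul0r subrr.
    by rewrite mulrBr.
  by lra.
have pq : dotp (\sum_l c 0 l *: w l) (w i - \sum_l c 0 l *: w l) = 0.
  rewrite dotp_suml big1 // => l _; rewrite dotpZl.
  by case: (ltnP l i) => [/orth ->|/c0 ->]; rewrite ?mulr0 ?mul0r.
exists (fun l => c 0 l); split=> //; split=> //.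
(* Orthogonality turns [|p|^2] into the dot product of [p] and [w i], a sum of [h] terms of size at
   most [2 e * e]; since [h e <= 1 / 8], this is at most [e / 4]. *)
move: pq; rewrite dotpDr dotpNr => /eqP; rewrite subr_eq0 => /eqP <-.
rewrite dotp_suml.
have : \sum_l dotp (c 0 l *: w l) (w i) <= \sum_(l < h) 2 * e * e.
  apply: ler_sum => l _; rewrite dotpZl.
  case: (ltnP l i) => [li|/c0 ->]; last by rewrite mul0r !mulr_ge0.
  apply: le_trans (ler_norm _) _; rewrite normrM ler_pM //.
  by have := bP l; rewrite mxE li.
rewrite sumr_const card_ord -[_ *+ h]mulr_natl => H; apply: le_trans H _.
have : h%:R * e * e <= 1 / 8 * e by apply: ler_wpM2r.
by lra.
Qed.

Lemma perturbed_gram_schmidt :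
  exists u : 'I_h -> 'cV[R]_n,
    [/\ orthonormal_family u,
        forall i, exists a : 'I_h -> R, u i = \sum_l a l *: w l
      & forall i, dotp (w i - u i) (w i - u i) <= 2 * e].
Proof.
have [c cP] := fin_all_exists near_orthonormal_residual.
pose p (i : 'I_h) : 'cV[R]_n := \sum_l c i l *: w l.
pose q (i : 'I_h) : 'cV[R]_n := w i - p i.
have pq i : dotp (p i) (q i) = 0 by case: (cP i) => _ _ [].
have pe i : dotp (p i) (p i) <= e by case: (cP i) => _ _ [].
have wE i : w i = p i + q i by rewrite /q addrC subrK.
have wq (i j : 'I_h) : (j < i)%N -> dotp (w j) (q i) = 0 by case: (cP i) => _ /(_ j).
have qE i : q i = w i - p i by [].
clearbody q.
(* Pythagoras: [|q|^2 = |w|^2 - |p|^2], where [|w|^2] is within [e] of 1 and [|p|^2 <= e]. *)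
have ppe i : `|dotp (q i) (q i) - 1| <= 2 * e.
  have := w_near_orthonormal i i; rewrite eqxx mulr1n wE !dotpE.
  rewrite (dotpC (q i)) pq; have := pe i; have := dotp_ge0 (p i); rewrite !ler_norml.
  by move=> h1 h2 /andP[h3 h4]; apply/andP; split; lra.
have q0 i : 0 < dotp (q i) (q i).
  by have := ppe i; have := near_orthonormal_err_le i; rewrite ler_norml => h1 /andP[h2 _]; lra.
pose s i := norm2 (q i).
have s0 i : 0 < s i by rewrite sqrtr_gt0.
have sE i : s i ^+ 2 = dotp (q i) (q i) by rewrite norm2_sqr.
(* [q j] combines only the [w l] with [l <= j], all orthogonal to [q i]. *)
have qq (i j : 'I_h) : (j < i)%N -> dotp (q j) (q i) = 0.
  move=> ji; rewrite [q j]qE dotpDl dotpNl wq // /p dotp_suml big1 ?subr0 //.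
  move=> l _; rewrite dotpZl; case: (ltnP l j) => [lj|jl].
    by rewrite wq ?mulr0 // (ltn_trans lj).
  by case: (cP j) => -> // _ _; rewrite mul0r.
exists (fun i => (s i)^-1 *: q i); split.
- move=> i j; rewrite !dotpE; case: eqVneq => [<-|ij].
    by rewrite -sE mulr1n; field; rewrite gt_eqF.
  suff -> : dotp (q i) (q j) = 0 by rewrite !mulr0.
  case: (ltngtP i j) => [/qq //|/qq|/val_inj ij']; first by rewrite dotpC.
  by rewrite ij' eqxx in ij.
- move=> i; exists (fun l => (s i)^-1 * ((l == i)%:R - c i l)).
  under eq_bigr do rewrite -scalerA scalerBl.
  rewrite qE.
  rewrite -scaler_sumr sumrB (bigD1 i) //= eqxx scale1r big1 ?addr0 //.
  by move=> l /negPf ->; rewrite scale0r.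
- move=> i; have si := s0 i.
  (* The two summands are orthogonal, so the squared error is [|p|^2 + (s - 1)^2]. As [s > 0],
     [(s - 1)^2 <= (s^2 - 1)^2 <= 4 e^2], and [e <= 1 / 8] makes the total at most [2 e]. *)
  have -> : w i - (s i)^-1 *: q i = p i + (1 - (s i)^-1) *: q i.
    by rewrite {1}wE scalerBl scale1r addrA.
  rewrite !dotpE (dotpC (q i)) pq -sE.
  have -> : dotp (p i) (p i) + (1 - (s i)^-1) * 0
      + ((1 - (s i)^-1) * 0 + (1 - (s i)^-1) * ((1 - (s i)^-1) * s i ^+ 2))
      = dotp (p i) (p i) + (s i - 1) ^+ 2.
    by field; rewrite gt_eqF.
  have := pe i; have := ppe i; rewrite -sE => h1 h2.
  have h3 : (s i ^+ 2 - 1) ^+ 2 <= (2 * e) ^+ 2.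
    by rewrite -[_ ^+ 2 in leLHS]ger0_norm ?sqr_ge0 // normrX lerXn2r ?nnegrE
      ?mulr_ge0 ?(near_orthonormal_err_ge0 i).
  have h4 : (s i - 1) ^+ 2 <= (s i ^+ 2 - 1) ^+ 2.
    have -> : (s i ^+ 2 - 1) ^+ 2 = (s i - 1) ^+ 2 * (s i + 1) ^+ 2 by ring.
    by rewrite ler_peMr ?sqr_ge0 //; nra.
  have := near_orthonormal_err_ge0 i; have := near_orthonormal_err_le i; nra.
Qed.

End PerturbedGramSchmidt.

(** * Eigenbasis expansion and Rayleigh quotients *)

Section Rayleigh.
Variables (R : realType) (n : nat).

(** Orthonormality says [V^T V = 1]; since [V] is square, also [V V^T = 1], which is
    completeness. *)
Lemma orthonormal_basis_expansion (v : 'I_n -> 'cV[R]_n) f :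
  orthonormal_family v -> f = \sum_l dotp f (v l) *: v l.
Proof.
move=> vP; pose V := \matrix_(i, l) v l i 0.
have VV : V^T *m V = 1%:M.
  apply/matrixP => i j; rewrite !mxE -vP; apply: eq_bigr => k _.
  by rewrite !mxE.
rewrite -{1}[f]mul1mx -(mulmx1C VV) -mulmxA.
apply/matrixP => i j; rewrite ord1 mxE summxE; apply: eq_bigr => l _.
rewrite !mxE mulrC; congr (_ * _).
by apply: eq_bigr => k _; rewrite !mxE mulrC.
Qed.

(* The easy half of Courant-Fischer: some nonzero vector of the h-dimensional
   span of [r] is orthogonal to the first [j < h] eigenvectors. *)
Lemma eigenvalue_le_rayleigh (M : 'M[R]_n) lam v h (r : 'I_h -> 'cV[R]_n) b
    (j : 'I_n) :
    ordered_eigenbasis M lam v -> orthonormal_family r -> (j < h)%N ->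
    (forall a : 'I_h -> R, let f := \sum_i a i *: r i in
      dotp f (M *m f) <= b * dotp f f) ->
  lam j <= b.
Proof.
move=> [lamP vP MvP] rP jh fP.
(* [N] has rank at most [j < h], so its left kernel contains a nonzero row: the coordinates of the
   test vector [f]. *)
pose N := \matrix_(i < h, l < j) dotp (r i) (v (widen_ord (ltnW (ltn_ord j)) l)).
pose a := nz_row (kermx N).
have aN0 : a != 0.
  rewrite nz_row_eq0 kermx_eq0 -row_leq_rank -ltnNge.
  exact: leq_ltn_trans (rank_leq_col N) jh.
have aN : a *m N = 0 by apply/sub_kermxP/nz_row_sub.
pose f := \sum_i a 0 i *: r i.
have f0 (l : 'I_n) : (l < j)%N -> dotp f (v l) = 0.
  move=> lj; have := congr1 (fun m : 'rV[R]_j => m 0 (Ordinal lj)) aN.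
  rewrite [RHS]mxE => <-; rewrite dotp_suml mxE; apply: eq_bigr => i _.
  by rewrite dotpZl mxE; congr (_ * dotp _ (v _)); apply: val_inj.
have ffE : dotp f f = \sum_l dotp f (v l) * dotp f (v l).
  by rewrite {1 2}(orthonormal_basis_expansion f vP) dotp_orthonormal_sum.
have fMf : dotp f (M *m f) = \sum_l lam l * (dotp f (v l) * dotp f (v l)).
  rewrite {2}(orthonormal_basis_expansion f vP) mulmx_sumr dotp_sumr.
  by apply: eq_bigr => l _; rewrite -scalemxAr MvP !dotpZr; ring.
have f_gt0 : 0 < dotp f f.
  rewrite lt_def dotp_ge0 andbT; apply: contra aN0.
  rewrite dotp_orthonormal_sum // psumr_eq0 => [/allP H|i _]; last first.
    by rewrite -expr2 sqr_ge0.
  apply/eqP/rowP => i; rewrite [RHS]mxE; apply/eqP.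
  by have := H i (mem_index_enum _); rewrite mulf_eq0 orbb.
rewrite -(ler_pM2r f_gt0); apply: le_trans (fP (fun i => a 0 i)).
(* Only indices [l >= j] contribute, and there [lam l >= lam j]. *)
rewrite -/f fMf ffE mulr_sumr; apply: ler_sum => l _.
case: (ltnP l j) => [/f0 ->|jl]; first by rewrite !mulr0.
by rewrite ler_wpM2r ?lamP // -expr2 sqr_ge0.
Qed.

End Rayleigh.

(** * Orthogonal projection onto the span of an orthonormal family *)

Section Projection.
Variables (R : realType) (n h : nat) (r : 'I_h -> 'cV[R]_n).
Hypothesis rP : orthonormal_family r.

Definition proj v : 'cV[R]_n := \sum_i dotp v (r i) *: r i.

Lemma dotp_proj u v : dotp (proj u) (proj v) = \sum_i dotp u (r i) * dotp v (r i).
Proof. exact: dotp_orthonormal_sum. Qed.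

Lemma dotp_projr u v : dotp u (proj v) = dotp (proj u) (proj v).
Proof.
rewrite dotp_proj dotp_sumr; apply: eq_bigr => i _.
by rewrite dotpZr mulrC.
Qed.

(** Polarized Pythagoras. For orthonormal [u], [v] it shows that the Gram matrix of the projections
    misses the identity by exactly the Gram matrix of the residuals. *)
Lemma dotp_residual u v :
  dotp (u - proj u) (v - proj v) = dotp u v - dotp (proj u) (proj v).
Proof.
rewrite !dotpE (dotpC (proj u) v) (dotp_projr u v) (dotp_projr v u).
by rewrite (dotpC (proj v)); ring.
Qed.

(** The two sides differ by the sum of squares of the coefficient differences. *)
Lemma proj_closest v (b : 'I_h -> R) (y := \sum_i b i *: r i) :
  dotp (v - proj v) (v - proj v) <= dotp (v - y) (v - y).
Proof.
rewrite dotp_residual dotp_proj !dotpE (dotpC y v) dotp_orthonormal_sum //.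
have -> : dotp v y = \sum_i b i * dotp v (r i).
  by rewrite dotp_sumr; apply: eq_bigr => i _; rewrite dotpZr.
have : 0 <= \sum_i (dotp v (r i) - b i) ^+ 2.
  by apply: sumr_ge0 => i _; rewrite sqr_ge0.
have -> : \sum_i (dotp v (r i) - b i) ^+ 2 =
    \sum_i dotp v (r i) * dotp v (r i) - 2 * (\sum_i b i * dotp v (r i))
    + \sum_i b i * b i.
  rewrite mulr_sumr -sumrB -big_split; apply: eq_bigr => i _ /=.
  by ring.
by lra.
Qed.

End Projection.

(** * Cheeger's inequality inside a vertex set *)

Section Cheeger.
Variables (R : realType) (n : nat) (d : R) (A : 'M[R]_n).
Hypothesis Areg : weighted_regular d A.
Implicit Types (S T : {set 'I_n}) (f F : 'I_n -> R).

Let d0 : 0 < d. Proof. by case: Areg. Qed.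
Let A0 x y : 0 <= A x y. Proof. by case: Areg. Qed.
Let AC x y : A x y = A y x.
Proof. by case: Areg => _ sA _ _; rewrite -[in LHS]sA mxE. Qed.
Let Ad x : \sum_y A x y = d. Proof. by case: Areg. Qed.

Lemma sum_edges_left_le S f : (forall x, 0 <= f x) ->
  \sum_(x in S) \sum_(y in S) A x y * f x <= d * \sum_(x in S) f x.
Proof.
move=> f0; rewrite mulr_sumr; apply: ler_sum => x _.
rewrite -mulr_suml ler_wpM2r // -(Ad x) [leRHS](bigID (mem S)) /=.
by rewrite lerDl sumr_ge0.
Qed.

Lemma sum_edges_right_le S f : (forall x, 0 <= f x) ->
  \sum_(x in S) \sum_(y in S) A x y * f y <= d * \sum_(x in S) f x.
Proof.
move=> f0; rewrite exchange_big; apply: le_trans (sum_edges_left_le S f0).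
by apply: ler_sum => x _; apply: ler_sum => y _; rewrite AC.
Qed.

Lemma cut_weightE S T : T \subset S ->
  cut_weight A T (S :\: T) =
  \sum_(x in S) \sum_(y in S) A x y * ((x \in T) && (y \notin T))%:R.
Proof.
move=> TS; rewrite /cut_weight big_mkcond [RHS]big_mkcond.
apply: eq_bigr => x _; case: ifP => xT; last first.
  by case: ifP => // _; rewrite big1 // => y _; rewrite mulr0.
rewrite (subsetP TS) // big_mkcond [RHS]big_mkcond; apply: eq_bigr => y _.
by rewrite in_setD; case: (y \in S) (y \in T) => [] []; rewrite ?mulr1 ?mulr0.
Qed.

Section Expander.
Variables (S : {set 'I_n}) (phi : R).
Hypothesis phi0 : 0 < phi.
Hypothesis expand : forall T, T \subset S -> (2 * #|T| <= #|S|)%N ->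
  phi * d * #|T|%:R <= cut_weight A T (S :\: T).

(* Coarea inequality: peel off the level sets of [F] one at a time. *)
Lemma coarea F : (forall x, 0 <= F x) ->
    (2 * #|[set x in S | (0 < F x)%R]| <= #|S|)%N ->
  2 * (phi * d) * \sum_(x in S) F x <=
    \sum_(x in S) \sum_(y in S) A x y * `|F x - F y|.
Proof.
(* Induction on the size of the support [T]: subtracting the minimum [t] of [F] on [T] from all of
   [T] removes at least the minimizer [x0]. *)
have [m] := ubnP #|[set x in S | (0 < F x)%R]|.
elim: m F => // m IH F; set T := [set x in S | _] => Tm F0 TS2.
have TS : T \subset S by apply/subsetP => x; rewrite inE => /andP[].
have FN x : x \in S -> x \notin T -> F x = 0.
  move=> xS; rewrite /T inE xS /= -leNgt => Fx.
  by apply: le_anti; rewrite Fx F0.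
case: (set_0Vmem T) => [T0|[x1 x1T]].
  rewrite big1 => [|x xS]; last by rewrite FN // T0 inE.
  rewrite mulr0 sumr_ge0 // => x _; rewrite sumr_ge0 // => y _.
  by rewrite mulr_ge0.
have [x0 x0M x0min] := arg_minP F x1T; have x0T : x0 \in T by [].
set t := F x0 in x0min.
have t0 : 0 < t by move: x0T; rewrite inE => /andP[].
pose G x := F x - t * (x \in T)%:R.
have G0 x : 0 <= G x.
  by rewrite /G; case: (boolP (x \in T)) => [/x0min|_];
     rewrite ?mulr1 ?mulr0 ?subr0 // subr_ge0.
have GT : [set x in S | 0 < G x] \subset T :\ x0.
  apply/subsetP => x; rewrite inE => /andP[xS]; rewrite /G in_setD1.
  case: (boolP (x \in T)) => [xT|xT]; last by rewrite FN // mulr0 subrr ltxx.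
  by rewrite mulr1 andbT; case: eqP => // ->; rewrite subrr ltxx.
have cT : #|T| = (#|T :\ x0|).+1 by rewrite (cardsD1 x0) x0T.
have cG := subset_leq_card GT.
(* Passing from [F] to [G] changes only the edges leaving [T], by [t] each; every such edge occurs
   in both orders, whence the factor 2. *)
have -> : \sum_(x in S) \sum_(y in S) A x y * `|F x - F y| =
   \sum_(x in S) \sum_(y in S) A x y * `|G x - G y| +
   2 * t * cut_weight A T (S :\: T).
  have -> : 2 * t * cut_weight A T (S :\: T) =
     t * cut_weight A T (S :\: T) +
     t * \sum_(x in S) \sum_(y in S) A x y * ((y \in T) && (x \notin T))%:R.
    suff -> : cut_weight A T (S :\: T) = \sum_(x in S) \sum_(y in S)
      A x y * ((y \in T) && (x \notin T))%:R by ring.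
    rewrite cut_weightE // exchange_big; apply: eq_bigr => x _.
    by apply: eq_bigr => y _; rewrite AC.
  rewrite cut_weightE // -mulrDr -!big_split mulr_sumr -big_split /=.
  apply: eq_bigr => x xS; rewrite -!big_split mulr_sumr -big_split /=.
  apply: eq_bigr => y yS; rewrite -mulrDr mulrCA -mulrDr; congr (_ * _).
  rewrite /G; case: (boolP (x \in T)) => xT; case: (boolP (y \in T)) => yT /=;
    rewrite ?addr0 ?add0r ?mulr1 ?mulr0 ?subr0 ?addr0.
  - by congr `|_|; ring.
  - have := x0min x xT; rewrite (FN y) // !subr0 -/t => H.
    by rewrite !ger0_norm ?subrK // subr_ge0.
  - have := x0min y yT; rewrite (FN x) // !sub0r !normrN -/t => H.
    by rewrite !ger0_norm ?subrK // subr_ge0.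
  - by [].
have -> : \sum_(x in S) F x = \sum_(x in S) G x + t * #|T|%:R.
  rewrite -sum1_card natr_sum mulr_sumr (big_setID T) (setIidPr TS) /=.
  rewrite [X in _ = X + _](big_setID T) (setIidPr TS) /= addrAC -big_split /=.
  congr (_ + _); apply: eq_bigr => x; rewrite /G.
    by move=> ->; rewrite mulr1 subrK.
  by rewrite in_setD => /andP[/negPf -> _]; rewrite mulr0 subr0.
have := ler_wpM2l (ltW t0) (expand TS TS2).
have Gm : (#|[set x in S | (0 < G x)%R]| < m)%N.
  by rewrite (leq_ltn_trans cG) // -ltnS -cT.
have := IH G Gm G0; rewrite (leq_trans _ TS2) ?leq_mul2l ?cT ?(leqW cG) //.
move=> /(_ isT).
by lra.
Qed.

(** Apply [coarea] to [f^2] and factor the difference of squares. The AM-GM weight is chosen so that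
    the error term is at most [phi d W], half of the coarea lower bound [2 phi d W]. *)
Lemma cheeger_nonneg f : (forall x, 0 <= f x) ->
    (2 * #|[set x in S | (0 < f x)%R]| <= #|S|)%N ->
  phi ^+ 2 * d * \sum_(x in S) f x ^+ 2 <=
    \sum_(x in S) \sum_(y in S) A x y * (f x - f y) ^+ 2.
Proof.
move=> f0 fS.
have F0 x : 0 <= f x ^+ 2 by rewrite sqr_ge0.
have := coarea F0; set W := \sum_(x in S) _ ^+ 2 => H.
have {}H : 2 * (phi * d) * W <=
    \sum_(x in S) \sum_(y in S) A x y * `|f x ^+ 2 - f y ^+ 2|.
  apply: H; rewrite (_ : [set x in S | 0 < f x ^+ 2] = [set x in S | 0 < f x]) //.
  by apply/setP => x; rewrite !inE exprn_even_gt0 //= lt_def f0 andbT.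
have Hl := sum_edges_left_le S F0; have Hr := sum_edges_right_le S F0.
set E := \sum_(x in S) _.
have : \sum_(x in S) \sum_(y in S) A x y * `|f x ^+ 2 - f y ^+ 2| <=
  phi^-1 * E + phi / 2 * (\sum_(x in S) \sum_(y in S) A x y * f x ^+ 2
      + \sum_(x in S) \sum_(y in S) A x y * f y ^+ 2).
  rewrite -big_split !mulr_sumr -big_split /=; apply: ler_sum => x _.
  rewrite -big_split !mulr_sumr -big_split /=; apply: ler_sum => y _.
  rewrite -mulrDr !(mulrCA _ (A x y)) -mulrDr ler_wpM2l //.
  have -> : f x ^+ 2 - f y ^+ 2 = (f x - f y) * (f x + f y) by ring.
  rewrite normrM (ger0_norm (addr_ge0 (f0 x) (f0 y))).
  rewrite -(real_normK (num_real (f x - f y))).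
  set u := `|f x - f y|; set s := f x + f y.
  (* AM-GM: [u s <= u^2 / phi + phi s^2 / 4] *)
  have : 0 <= phi^-1 * (u - phi / 2 * s) ^+ 2.
    by rewrite mulr_ge0 ?invr_ge0 ?sqr_ge0 ?ltW.
  have -> : phi^-1 * (u - phi / 2 * s) ^+ 2 =
    phi^-1 * u ^+ 2 - u * s + phi / 4 * s ^+ 2 by field; rewrite gt_eqF.
  have : phi / 4 * s ^+ 2 <= phi / 2 * (f x ^+ 2 + f y ^+ 2).
    have : 0 <= phi * (f x - f y) ^+ 2 by rewrite mulr_ge0 ?sqr_ge0 ?ltW.
    by rewrite /s; lra.
  by lra.
move=> H2; have H3 : phi * d * W <= phi^-1 * E.
  have : phi / 2 * (\sum_(x in S) \sum_(y in S) A x y * f x ^+ 2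
      + \sum_(x in S) \sum_(y in S) A x y * f y ^+ 2) <= phi / 2 * (2 * (d * W)).
    by apply: ler_wpM2l; [rewrite divr_ge0 ?ltW | rewrite -/W in Hl Hr; lra].
  by lra.
have := ler_wpM2l (ltW phi0) H3.
by rewrite mulVKf ?gt_eqF // expr2 !mulrA.
Qed.

(** Take the least value on [S] with at most half of [S] strictly above it. The next smaller value,
    if any, has more than half of [S] above it, and what remains is exactly the set below the
    median. *)
Lemma exists_median f : exists m,
  (2 * #|[set x in S | (m < f x)%R]| <= #|S|)%N /\
  (2 * #|[set x in S | (f x < m)%R]| <= #|S|)%N.
Proof.
case: (set_0Vmem S) => [->|[x1 x1S]].
  by exists 0; split; rewrite (eqP (_ : #|_| == 0)%N) ?muln0 // cards_eq0;
     apply/eqP/setP => x; rewrite !inE.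
pose P x := (x \in S) && (2 * #|[set y in S | (f x < f y)%R]| <= #|S|)%N.
have [xM xMM xMmax] := arg_maxP f x1S; have xMS : xM \in S by [].
have PM : P xM.
  rewrite /P xMS (_ : [set y in S | _] = set0) ?cards0 //.
  by apply/setP => y; rewrite !inE; apply/negP => /andP[/xMmax /le_gtF ->].
have [m /andP[mS mP] mmin] := arg_minP f PM.
exists (f m); split=> //.
case: (set_0Vmem [set x in S | f x < f m]) => [->|[z1]]; first by rewrite cards0.
move=> z1P; have [z zP zmax] := arg_maxP f z1P.
have /[!inE] /andP[zS zm] : z \in [set x in S | f x < f m] by [].
have : ~~ P z by apply/negP => /mmin; rewrite leNgt zm.
rewrite /P zS /= -ltnNge => H.
have HS : (#|[set x in S | (f z < f x)%R]| + #|[set x in S | (f x < f m)%R]|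
    = #|S|)%N.
  have sub : [set x in S | f x < f m] \subset S.
    by apply/subsetP => x; rewrite inE => /andP[].
  have -> : [set x in S | f z < f x] = S :\: [set x in S | f x < f m].
    apply/setP => x; rewrite !inE; case: (boolP (x \in S)) => //= xS.
    rewrite -leNgt andbT; apply/idP/idP => [zx|mx]; last exact: lt_le_trans mx.
    rewrite leNgt; apply/negP => xm.
    have xin : x \in [set x in S | f x < f m] by rewrite inE xS.
    by have := zmax x xin; rewrite /= leNgt zx.
  by rewrite addnC -[RHS](cardsID [set x in S | f x < f m]) (setIidPr sub).
by move: H; rewrite -HS !mul2n -!addnn ltn_add2l leq_add2r => /ltnW.
Qed.

(** Centre [f] at a median: its positive and negative parts are each supported on at most half of
    [S], so [cheeger_nonneg] applies to both. *)
Lemma cheeger f : exists m,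
  phi ^+ 2 * d * \sum_(x in S) (f x - m) ^+ 2 <=
    \sum_(x in S) \sum_(y in S) A x y * (f x - f y) ^+ 2.
Proof.
have [m [mr ml]] := exists_median f; exists m.
pose g x := Num.max (f x - m) 0; pose g' x := Num.max (m - f x) 0.
have := @cheeger_nonneg g; have := @cheeger_nonneg g'.
have -> : [set x in S | 0 < g x] = [set x in S | m < f x].
  by apply/setP => x; rewrite !inE lt_max ltxx orbF subr_gt0.
have -> : [set x in S | 0 < g' x] = [set x in S | f x < m].
  by apply/setP => x; rewrite !inE lt_max ltxx orbF subr_gt0.
have g0 x : 0 <= g x by rewrite le_max lexx orbT.
have g'0 x : 0 <= g' x by rewrite le_max lexx orbT.
have gE x : [/\ g x = f x - m, g' x = 0 & m <= f x] \/
            [/\ g x = 0, g' x = m - f x & f x <= m].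
  rewrite /g /g'; have [mx|/ltW mx] := leP m (f x); [left | right].
    by rewrite max_l ?max_r ?subr_le0 ?subr_ge0.
  by rewrite max_r ?max_l ?subr_le0 ?subr_ge0.
move=> /(_ g'0 ml) H' /(_ g0 mr) H.
have -> : \sum_(x in S) (f x - m) ^+ 2 =
    \sum_(x in S) g x ^+ 2 + \sum_(x in S) g' x ^+ 2.
  rewrite -big_split; apply: eq_bigr => x _ /=.
  by case: (gE x) => -[-> -> _]; ring.
rewrite mulrDr; apply: le_trans (lerD H H') _.
rewrite -big_split; apply: ler_sum => x _; rewrite -big_split; apply: ler_sum.
move=> y _ /=; rewrite -mulrDr ler_wpM2l //.
(* For values on opposite sides of [m] the cross term is nonnegative, so splitting does not increase
   the energy. *)
by case: (gE x) => -[-> -> ?]; case: (gE y) => -[-> -> ?]; nra.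
Qed.

End Expander.
End Cheeger.

(** * The Laplacian energy and the clusters *)

Section Clusters.
Variables (R : realType) (n : nat) (d : R) (A : 'M[R]_n).
Hypothesis Areg : weighted_regular d A.

Let d0 : 0 < d. Proof. by case: Areg. Qed.
Let A0 x y : 0 <= A x y. Proof. by case: Areg. Qed.
Let AC x y : A x y = A y x.
Proof. by case: Areg => _ sA _ _; rewrite -[in LHS]sA mxE. Qed.
Let Ad x : \sum_y A x y = d. Proof. by case: Areg. Qed.

Lemma inner_conductance_expand (phi : R) (S T : {set 'I_n}) :
    phi <= inner_conductance d A S -> T \subset S -> (2 * #|T| <= #|S|)%N ->
  phi * d * #|T|%:R <= cut_weight A T (S :\: T).
Proof.
move=> phiS TS TS2; case: (eqVneq T set0) => [->|T0].
  by rewrite cards0 mulr0 sumr_ge0 // => x _; rewrite sumr_ge0.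
have T_gt0 : 0 < d * #|T|%:R by rewrite mulr_gt0 // ltr0n card_gt0.
rewrite -mulrA -ler_pdivlMr //; apply: le_trans phiS _.
have : cut_weight A T (S :\: T) / (d * #|T|%:R) \in inner_ratios d A S.
  by apply/mapP; exists T => //; rewrite mem_enum inE T0 TS.
(* Membership excludes the empty list and its default value 1; the head [x] is the initial value of
   the minimum and is treated separately. *)
rewrite /inner_conductance; case: inner_ratios => // x s.
rewrite inE => /orP[/eqP <-|ys]; first exact: bigmin_le_id.
exact: (@ge_bigmin_seq _ _ _ s x _ xpredT id).
Qed.

(** Expand the square; by symmetry and regularity each pure square sums to [d |f|^2]. The factor 2
    reflects ordered pairs. *)
Lemma laplacian_energy (f : 'cV[R]_n) :
  2 * d * dotp f (laplacian d A *m f) =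
    \sum_x \sum_y A x y * (f x 0 - f y 0) ^+ 2.
Proof.
have -> : \sum_x \sum_y A x y * (f x 0 - f y 0) ^+ 2 =
    \sum_x \sum_y A x y * f x 0 ^+ 2 + \sum_x \sum_y A x y * f y 0 ^+ 2
    - 2 * \sum_x f x 0 * \sum_y A x y * f y 0.
  rewrite mulr_sumr -big_split -sumrB; apply: eq_bigr => x _ /=.
  rewrite !mulr_sumr -big_split -sumrB; apply: eq_bigr => y _ /=.
  by ring.
have -> : \sum_x \sum_y A x y * f x 0 ^+ 2 = d * dotp f f.
  by rewrite mulr_sumr; apply: eq_bigr => x _; rewrite -mulr_suml Ad expr2.
have -> : \sum_x \sum_y A x y * f y 0 ^+ 2 = d * dotp f f.
  rewrite exchange_big mulr_sumr; apply: eq_bigr => x _.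
  by under eq_bigr do rewrite AC; rewrite -mulr_suml Ad expr2.
rewrite mulmxBl mul1mx -scalemxAl !dotpE.
have -> : dotp f (A *m f) = \sum_x f x 0 * \sum_y A x y * f y 0.
  by apply: eq_bigr => x _; rewrite mxE.
by field; rewrite gt_eqF.
Qed.

Variables (h : nat) (C : 'I_h -> {set 'I_n}).

(** The class map [cl] turns membership in a cluster into an equation between indices. *)
Lemma partition_class : injective C ->
    partition [set C i | i : 'I_h] [set: 'I_n] ->
  exists cl : 'I_n -> 'I_h, forall x j, (x \in C j) = (cl x == j).
Proof.
move=> Cinj /and3P[/eqP covC /trivIsetP trC _].
apply: (fin_all_exists (P := fun x i => forall j, (x \in C j) = (i == j))) => x.
have : x \in cover [set C i | i : 'I_h] by rewrite covC.
move=> /bigcupP[_ /imsetP[i _ ->] xi]; exists i => j.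
case: eqVneq => [<- //|ij]; apply/negP => xj.
have := trC (C i) (C j) (imset_f _ _) (imset_f _ _).
rewrite (inj_eq Cinj) ij => /(_ isT isT isT) /pred0P /(_ x) /=.
by rewrite xi xj.
Qed.

Lemma partition_card_gt0 : partition [set C i | i : 'I_h] [set: 'I_n] ->
  forall i, 0 < #|C i|%:R :> R.
Proof.
move=> /and3P[_ _ C0] i; rewrite ltr0n card_gt0; apply: contra C0 => /eqP <-.
exact: imset_f.
Qed.

Variables (cl : 'I_n -> 'I_h).
Hypothesis clP : forall x j, (x \in C j) = (cl x == j).
Hypothesis C_gt0 : forall j, 0 < #|C j|%:R :> R.

Let r j := normalized_indicator R (C j).

Let sC j : 0 < Num.sqrt (#|C j|%:R : R). Proof. by rewrite sqrtr_gt0. Qed.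

Lemma sum_normalized_indicatorE (a : 'I_h -> R) x :
  (\sum_i a i *: r i) x 0 = a (cl x) / Num.sqrt #|C (cl x)|%:R.
Proof.
rewrite summxE (bigD1 (cl x)) //= !mxE clP eqxx mulr1 big1 ?addr0 // => j jN.
by rewrite !mxE clP eq_sym (negPf jN) !mulr0.
Qed.

Lemma sum_by_class (F : 'I_n -> R) :
  \sum_x F x = \sum_j \sum_(x in C j) F x.
Proof.
rewrite (partition_big cl xpredT) //=; apply: eq_bigr => j _.
by apply: eq_bigl => x; rewrite clP.
Qed.

Lemma normalized_indicator_orthonormal : orthonormal_family r.
Proof.
move=> i j; have -> : dotp (r i) (r j) = \sum_(x in C i)
    (Num.sqrt #|C i|%:R)^-1 * (r j x 0).
  rewrite [RHS]big_mkcond; apply: eq_bigr => x _; rewrite {1}/r !mxE.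
  by case: ifP; rewrite ?mulr1 ?mulr0 ?mul0r.
have -> : \sum_(x in C i) (Num.sqrt #|C i|%:R)^-1 * (r j x 0) =
    \sum_(x in C i) (i == j)%:R / #|C i|%:R.
  apply: eq_bigr => x; rewrite !mxE !clP => /eqP <-.
  case: eqVneq => [<-|_]; last by rewrite !mulr0 mul0r.
  by rewrite mulr1 mul1r -invfM -expr2 sqr_sqrtr // ltW.
rewrite sumr_const -[_ *+ #|_|]mulr_natr mulrVK //.
by rewrite unitfE gt_eqF.
Qed.

(** [f] is constant on clusters, so only edges between clusters carry energy. Bounding [(x - y)^2]
    by [2 x^2 + 2 y^2] gives [4 W], and [W] weights each cluster's outer cut by its squared
    value. *)
Lemma rayleigh_clusters_le (phi : R) (a : 'I_h -> R)
    (f := \sum_i a i *: r i) :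
    (forall j, conductance d A (C j) <= phi) ->
  dotp f (laplacian d A *m f) <= 2 * phi * dotp f f.
Proof.
move=> phiP; have d20 : 0 < 2 * d by rewrite mulr_gt0.
rewrite -(ler_pM2l d20) laplacian_energy.
pose g j := a j / Num.sqrt #|C j|%:R.
have fE x : f x 0 = g (cl x) by rewrite sum_normalized_indicatorE.
pose W := \sum_x \sum_y A x y * (cl x != cl y)%:R * f x 0 ^+ 2.
apply: (@le_trans _ _ (2 * W + 2 * W)).
  have {2}-> : W = \sum_x \sum_y A x y * (cl x != cl y)%:R * f y 0 ^+ 2.
    rewrite /W exchange_big; apply: eq_bigr => x _; apply: eq_bigr => y _.
    by rewrite AC eq_sym.
  rewrite -mulrDr -big_split mulr_sumr; apply: ler_sum => x _.
  rewrite -big_split mulr_sumr; apply: ler_sum => y _ /=.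
  rewrite !fE; case: eqVneq => [->|_] /=.
    by rewrite subrr expr0n /= !mulr0 !mul0r addr0 mulr0.
  rewrite !mulr1 -mulrDr [leRHS]mulrCA ler_wpM2l //.
  by have := sqr_ge0 (g (cl x) + g (cl y)); lra.
suff : W <= d * phi * dotp f f by lra.
rewrite /W sum_by_class /dotp (sum_by_class (fun x => _ * _)) mulr_sumr.
apply: ler_sum => j _.
have -> : \sum_(x in C j) \sum_y A x y * (cl x != cl y)%:R * f x 0 ^+ 2 =
    cut_weight A (C j) (~: C j) * g j ^+ 2.
  rewrite /cut_weight mulr_suml; apply: eq_bigr => x; rewrite clP fE => /eqP ->.
  rewrite -mulr_suml; congr (_ * _); rewrite [RHS]big_mkcond.
  apply: eq_bigr => y _; rewrite in_setC clP eq_sym.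
  by case: ifP => _; rewrite ?mulr1 ?mulr0.
have -> : \sum_(x in C j) f x 0 * f x 0 = #|C j|%:R * g j ^+ 2.
  rewrite mulr_natl -sumr_const; apply: eq_bigr => x.
  by rewrite clP fE => /eqP ->; rewrite expr2.
rewrite mulrA ler_wpM2r ?sqr_ge0 // -mulrA mulrCA -ler_pdivrMr ?mulr_gt0 //.
exact: phiP.
Qed.

(** The vector [y] equal to the Cheeger centre [m j] on each [C j] lies in the span of [r], so the
    projection is at least as close to [v]; the energy between clusters is dropped. *)
Lemma clusters_residual_le (phi : R) (v : 'cV[R]_n) : 0 < phi ->
    (forall j, phi <= inner_conductance d A (C j)) ->
  phi ^+ 2 * dotp (v - proj r v) (v - proj r v) <=
    2 * dotp v (laplacian d A *m v).
Proof.
move=> phi0 phiP.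
have /fin_all_exists[m mP] j :=
  cheeger Areg phi0 (fun T => inner_conductance_expand (phiP j)) (fun x => v x 0).
pose y := \sum_j (m j * Num.sqrt #|C j|%:R) *: r j.
have yE x : y x 0 = m (cl x).
  by rewrite sum_normalized_indicatorE mulfK // gt_eqF.
rewrite -(ler_pM2l d0) [leRHS]mulrA [d * 2]mulrC laplacian_energy.
have := proj_closest normalized_indicator_orthonormal v
  (fun j => m j * Num.sqrt #|C j|%:R); rewrite -/y => H.
apply: (@le_trans _ _ (phi ^+ 2 * d * dotp (v - y) (v - y))).
  rewrite mulrA [d * _]mulrC ler_wpM2l // mulr_ge0 ?sqr_ge0 ?ltW //.
rewrite /dotp sum_by_class mulr_sumr [leRHS]sum_by_class.
apply: ler_sum => j _; apply: le_trans (le_trans (mP j) _).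
  rewrite le_eqVlt; apply/orP; left; apply/eqP; congr (_ * _).
  by apply: eq_bigr => x; rewrite clP !mxE yE => /eqP ->; rewrite expr2.
apply: ler_sum => x _; rewrite [leRHS](bigID (mem (C j))) /= lerDl.
by rewrite sumr_ge0 // => z _; rewrite mulr_ge0 ?sqr_ge0.
Qed.

End Clusters.

(** * Eigenvectors close to the span of the cluster indicators *)

Theorem theorem5 (R : realType) :
  exists a c : R, [/\ 0 < a, 0 < c &
    forall (n k h : nat) (d phi_in phi_out : R) (A : 'M[R]_n)
           (C : 'I_h -> {set 'I_n})
           (lam : 'I_n -> R) (v : 'I_n -> 'cV[R]_n),
      0 < phi_in ->
      phi_out <= a * phi_in ^+ 2 / k%:R ^+ 2 ->
      weighted_regular d A ->
      clustering d A k phi_in phi_out C ->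
      ordered_eigenbasis (laplacian d A) lam v ->
      exists rt : 'I_h -> 'cV[R]_n,
        [/\ orthonormal_family rt,
            forall i : 'I_h,
              rt i \in <<[seq normalized_indicator R (C j) | j : 'I_h]>>%VS
          & forall (i : 'I_h) (j : 'I_n), j = i :> nat ->
              norm2 (v j - rt i) ^+ 2 <= c * (h%:R * phi_out / phi_in ^+ 2)]].
Proof.
(* With [a = 1 / 32], [e <= 4 a / k^2] gives [h e <= 1 / 8]. The final error is at most
   [2 (e + 2 e) = 6 e <= 6 h e], which is [24 h phi' / phi^2]. *)
exists (1 / 32), 24; split=> [|//|]; first by rewrite divr_gt0.
move=> n k h d phi phi' A C lam v phi0 phi'_le Areg.
move=> [hk Cinj Cpart Ccl] eigP.
have [cl clP] := partition_class Cinj Cpart.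
have C_gt0 := partition_card_gt0 R Cpart.
have rP := normalized_indicator_orthonormal clP C_gt0.
set r := fun j => normalized_indicator R (C j) in rP.
have phi2_gt0 : 0 < phi ^+ 2 by rewrite exprn_gt0.
(* One point from each cluster gives an injection, so the first [h] eigenvectors exist. *)
have hn : (h <= n)%N.
  rewrite -[h]card_ord -[n in (_ <= n)%N]card_ord.
  have [x xP] : exists x : 'I_h -> 'I_n, forall j, x j \in C j.
    apply: (fin_all_exists (P := fun j y => y \in C j)) => j.
    by have := C_gt0 j; rewrite ltr0n card_gt0 => /set0Pn.
  apply: (@leq_card _ _ x) => i j xij.
  move: (xP i) (xP j); rewrite !clP xij => /eqP <- /eqP cj.
  by rewrite cj.
pose o (i : 'I_h) : 'I_n := widen_ord hn i.
pose w i := proj r (v (o i)).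
pose e := 4 * phi' / phi ^+ 2.
have lam_le (j : 'I_n) : (j < h)%N -> lam j <= 2 * phi'.
  move=> jh; apply: (eigenvalue_le_rayleigh eigP rP jh) => a.
  by apply: (rayleigh_clusters_le Areg clP) => i; case: (Ccl i).
case: (eigP) => _ vP LvP.
have res i : dotp (v (o i) - w i) (v (o i) - w i) <= e.
  rewrite /e ler_pdivlMr // mulrC.
  apply: le_trans (clusters_residual_le Areg clP C_gt0 (v (o i)) phi0 _) _.
    by move=> j; case: (Ccl j).
  rewrite LvP dotpZr vP eqxx mulr1; have := lam_le (o i) (ltn_ord i); lra.
have wP i j : `|dotp (w i) (w j) - (i == j)%:R| <= e.
  have -> : (i == j)%:R = dotp (v (o i)) (v (o j)).
    by rewrite vP; congr (_%:R); apply/eqP/eqP => [->|/(congr1 val) /val_inj].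
  rewrite distrC -(dotp_residual rP).
  exact: normr_dotp_le.
(* The sign of [e] is derived from an index, so [h = 0] is handled apart below. *)
have e_ge0 (i : 'I_h) : 0 <= e by apply: le_trans (res i); exact: dotp_ge0.
have he : h%:R * e <= 1 / 8.
  case: (posnP h) => [->|h0]; first by rewrite mul0r divr_ge0.
  have k0 : 0 < k%:R :> R by rewrite ltr0n (leq_trans h0).
  have e_le : e <= 1 / 8 / k%:R ^+ 2.
    rewrite /e ler_pdivrMr //.
    have -> : 1 / 8 / k%:R ^+ 2 * phi ^+ 2 = 4 * (1 / 32 * phi ^+ 2 / k%:R ^+ 2).
      by field; rewrite gt_eqF.
    by rewrite -mulrA ler_wpM2l // mulrA.
  apply: (@le_trans _ _ (k%:R * (1 / 8 / k%:R ^+ 2))).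
    by apply: ler_pM => //; [exact: (e_ge0 (Ordinal h0)) | rewrite ler_nat].
  have -> : k%:R * (1 / 8 / k%:R ^+ 2) = 1 / 8 / k%:R :> R.
    by field; rewrite gt_eqF.
  by rewrite ler_pdivrMr // ler_peMr ?divr_ge0 // ler1n (leq_trans h0).
have [u [uP uspan uw]] := perturbed_gram_schmidt he wP.
exists u; split=> // [i|i j ji].
  have [a ->] := uspan i; apply: memv_suml => l _; apply: memvZ.
  apply: memv_suml => j _; apply: memvZ; apply: memv_span.
  by apply: map_f; rewrite mem_enum.
have -> : j = o i by apply: val_inj.
rewrite norm2_sqr (_ : v (o i) - u i = (v (o i) - w i) + (w i - u i)); last first.
  by rewrite addrA subrK.
apply: le_trans (dotp_sqrD_le _ _) _.
have : e <= h%:R * e.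
  by rewrite ler_peMl ?(e_ge0 i) // ler1n (leq_ltn_trans _ (ltn_ord i)).
have -> : 24 * (h%:R * phi' / phi ^+ 2) = 6 * (h%:R * e) by rewrite /e; ring.
have := res i; have := uw i; clear e_ge0.
by lra.
Qed.
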